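(* For every $k\in\mathbb{C}$ with $0<|k|<1$, \[\mathrm{m}\!\left(\frac{4}{k^2}+x+\frac1x+y+\frac1y\right)=\mathrm{m}\!\left(2\left(k+\frac1k\right)+x+\frac1x+y+\frac1y\right)+\mathrm{m}\!\left(2i\left(k-\frac1k\right)+x+\frac1x+y+\frac1y\right).\] Equivalently, with $\mu(t)=\mathrm{m}\!\left(\frac{4}{\sqrt t}+x+\frac1x+y+\frac1y\right)$, $\mu\!\left(\frac{4k^2}{(1+k^2)^2}\right)+\mu\!\left(\frac{-4k^2}{(1-k^2)^2}\right)=\mu(k^4)$.
   Context: $\mathrm{m}(P)=\int_0^1\int_0^1\log|P(e^{2\pi i\theta_1},e^{2\pi i\theta_2})|\,d\theta_1d\theta_2$ is the logarithmic Mahler measure of a Laurent polynomial with complex coefficients. *)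

(* Defs.v *)
From HB Require Import structures.
From mathcomp Require Import all_boot all_order all_algebra.
From mathcomp Require Import all_classical all_reals all_analysis.
From mathcomp Require Import complex.
Set Implicit Arguments. Unset Strict Implicit. Unset Printing Implicit Defensive.
Import Order.TTheory GRing.Theory Num.Theory.
Local Open Scope ring_scope.
Local Open Scope classical_set_scope.

Definition expi (R : realType) (t : R) : R[i] := Complex (cos t) (sin t).

Definition mahler2 (R : realType) (P : R[i] -> R[i] -> R[i]) : \bar R :=
  (\int[(@lebesgue_measure R \x @lebesgue_measure R)%E]_(t in `[0%R, 1%R] `*` `[0%R, 1%R])
     (ln (Normc.normc (P (expi (2 * pi * t.1)) (expi (2 * pi * t.2)))))%:E)%E.

(* Main.v *)
Require Import Defs.
From HB Require Import structures.
From mathcomp Require Import all_boot all_order all_algebra.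
From mathcomp Require Import all_classical all_reals all_analysis.
From mathcomp Require Import complex measurable_realfun ring lra.
Import Order.TTheory GRing.Theory Num.Theory.
Import numFieldNormedType.Exports.
Local Open Scope ring_scope.

(** With c = (cos(2 pi t1) + cos(2 pi t2)) / 2 ranging over [-1, 1], the three
    integrands are, up to constants a with matching products |a|, equal to
    ln|1 + k^2 c|, ln|1 + k^2 + 2kc| and ln|1 + (ik)^2 + 2(ik)c|, which are all
    nonsingular for |k| < 1.  Writing c = cos phi, the quadratic
    1 + k^2 + 2kc = (1 + k e^(i phi)) (1 + k e^(-i phi)) has a logarithm whose
    expansion in k involves the Chebyshev polynomials T_n(c).  Comparing power
    series in k, the theorem amounts to: E[T_n(c)] = 0 for odd n and
    2 E[T_(2j)(c)] = E[c^j] - E[c^(j-1)] for j > 0, with E[c^j] = 0 for odd j.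
    Since 2 T_n = U_n - U_(n-2), this follows from E[U_(2j)(c)] = E[c^j],
    because both sides satisfy (j+1)^2 s_(j+1) = j^2 s_(j-1): for the moments
    this is an integration by parts on the torus, and for U_(2j) it is the
    image of the moment recurrence under the Chebyshev differential equation.
    The series are only used through truncations with a geometric error. *)

Set Implicit Arguments. Unset Strict Implicit. Unset Printing Implicit Defensive.

Local Notation normc := Normc.normc.
Local Notation Re := complex.Re.
Local Notation Im := complex.Im.

(** * Chebyshev polynomials and moment functionals *)

Section Chebyshev.
Variable R : realFieldType.

(* The pair (T_n, V_n) with V_n = U_(n-1), i.e. cos(n phi) = T_n(cos phi) and
   sin(n phi) = sin phi * V_n(cos phi). *)
Fixpoint chebyshev n : {poly R} * {poly R} :=
  if n is m.+1 then
    let: (T, V) := chebyshev m in ('X * T - (1 - 'X^2) * V, 'X * V + T)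
  else (1, 0).

Definition chebT n := (chebyshev n).1.
Definition chebV n := (chebyshev n).2.

Lemma chebTS n : chebT n.+1 = 'X * chebT n - (1 - 'X^2) * chebV n.
Proof. by rewrite /chebT /chebV /=; case: chebyshev. Qed.

Lemma chebVS n : chebV n.+1 = 'X * chebV n + chebT n.
Proof. by rewrite /chebT /chebV /=; case: chebyshev. Qed.

(** This is 2 sin(phi) cos((n+1) phi) = sin((n+2) phi) - sin(n phi) divided by sin(phi). It reduces
    moments of [chebT] to moments of [chebV]. *)
Lemma chebT_chebV n : 2%:R * chebT n.+1 = chebV n.+2 - chebV n.
Proof. by rewrite !chebVS !chebTS; ring. Qed.

(** Differentiation of cos(n phi) and sin(n phi)/sin(phi) with respect to cos(phi); the factor 1 -
    X^2 keeps the second identity polynomial. Together they contain the Chebyshev differential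
    equation. *)
Lemma deriv_chebyshev n : (chebT n)^`() = n%:R * chebV n /\
  (1 - 'X^2) * (chebV n)^`() = 'X * chebV n - n%:R * chebT n.
Proof.
elim: n => [|n [dT dV]].
  by rewrite /chebT /chebV /= -polyC1 derivC deriv0; split; ring.
rewrite chebTS chebVS !poly.derivE !mul1r add0r -natr1 mulrDr mulrA.
split.
  by rewrite dV dT expr1; ring.
by rewrite mulrDr (mulrDr _ (chebV n)) mulrCA dV dT; ring.
Qed.

(* The operator encoding the recurrence of the moments: it maps 'X^n to
   (n + 1)^2 'X^(n + 1) - n^2 'X^(n - 1), hence is killed by pmoment. *)
Definition legop (h : {poly R}) : {poly R} :=
  ('X^2 - 1) * ('X * h^`()^`()) + 'X * h + (3%:R * 'X^2 - 1) * h^`().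

(** The Chebyshev equation removes the second derivative, and the rest is the three-term recurrence.
    The index n + 2 makes room for the lower term, which sits two places below that of [chebT]. *)
Lemma legop_chebT n : 4%:R * legop (chebT n.+2) =
  (n.+3%:R ^+ 2) * chebV n.+4 - (n.+1%:R ^+ 2) * chebV n.
Proof.
rewrite /legop.
have [dT dV] := deriv_chebyshev n.+2.
have -> : (chebT n.+2)^`()^`() = n.+2%:R * (chebV n.+2)^`().
  by rewrite dT !mulr_natl derivMn.
have -> : ('X^2 - 1) * ('X * (n.+2%:R * (chebV n.+2)^`())) =
   - ('X * n.+2%:R * ((1 - 'X^2) * (chebV n.+2)^`())) by ring.
by rewrite dV dT !(chebVS, chebTS) -!natr1; ring.
Qed.

Variable m : nat -> R.
Hypothesis m0 : m 0 = 1.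
(** At j = 0 the right-hand side is 0 whatever [j.-1] means, so this case says [m 1] = 0. *)
Hypothesis mS : forall j, (j.+1)%:R ^+ 2 * m j.+1 = j%:R ^+ 2 * m j.-1.

Definition pmoment (p : {poly R}) : R := \sum_(i < size p) p`_i * m i.

(** Padding with zero coefficients puts polynomials of different sizes over one index range, as
    linearity requires. *)
Lemma pmomentE n (p : {poly R}) : (size p <= n)%N ->
  pmoment p = \sum_(i < n) p`_i * m i.
Proof.
move=> le_pn; rewrite /pmoment (big_ord_widen n (fun i => p`_i * m i) le_pn).
rewrite big_mkcond; apply: eq_bigr => i _.
by case: ltnP => // le_pi; rewrite nth_default ?mul0r.
Qed.

Lemma pmoment_is_scalar : scalar pmoment.
Proof.
move=> a p q; pose n := maxn (size (a *: p + q)) (maxn (size p) (size q)).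
rewrite !(@pmomentE n) ?leq_max ?leqnn ?orbT//.
rewrite mulr_sumr -big_split; apply: eq_bigr => i _ /=.
by rewrite coefD coefZ mulrDl mulrA.
Qed.

HB.instance Definition _ :=
  GRing.isLinear.Build R {poly R} R *%R pmoment pmoment_is_scalar.

Lemma pmomentXn n : pmoment 'X^n = m n.
Proof.
rewrite (@pmomentE n.+1) ?size_polyXn// big_ord_recr/= big1 ?add0r.
  by rewrite coefXn eqxx mul1r.
by move=> i _; rewrite coefXn (ltn_eqF (ltn_ord i)) mul0r.
Qed.

Lemma legop_is_linear : linear legop.
Proof.
move=> a p q; rewrite /legop !poly.derivE -!mul_polyC; ring.
Qed.

HB.instance Definition _ :=
  GRing.isLinear.Build R {poly R} {poly R} _ legop legop_is_linear.

Lemma legopXn n : legop 'X^n = (n.+1%:R ^+ 2) *: 'X^(n.+1) - (n%:R ^+ 2) *: 'X^(n.-1).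
Proof.
have dX : ('X^n)^`() = n%:R * 'X^(n.-1) :> {poly R}.
  by rewrite derivXn mulr_natl.
have ddX : ('X^n)^`()^`() = n%:R * (n.-1%:R * 'X^(n.-2)) :> {poly R}.
  by rewrite dX mulr_natl derivMn derivXn !mulr_natl.
rewrite /legop ddX dX -!mul_polyC !rmorphXn !rmorph_nat {dX ddX}.
by case: n => [|[|n]] /=; rewrite ?exprS; ring.
Qed.

Lemma pmoment_legop h : pmoment (legop h) = 0.
Proof.
rewrite -[h]coefK poly_def !linear_sum big1// => i _.
rewrite linearZ /= linearZ /= legopXn.
rewrite [pmoment (_ - _)]linearB /= ![pmoment (_ *: _)]linearZ /= !pmomentXn.
by rewrite mS subrr mulr0.
Qed.

Lemma pmoment_natM a p : pmoment (a%:R * p) = a%:R * pmoment p.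
Proof. by rewrite mulr_natl raddfMn mulr_natl. Qed.

(** The functional [pmoment] applied to [legop_chebT], whose left-hand side it kills. *)
Lemma pmoment_chebV_rec n :
  n.+3%:R ^+ 2 * pmoment (chebV n.+4) = n.+1%:R ^+ 2 * pmoment (chebV n).
Proof.
apply/eqP; rewrite -subr_eq0 -!natrX -!pmoment_natM -raddfB /= !natrX -legop_chebT.
by rewrite pmoment_natM pmoment_legop mulr0.
Qed.

Lemma moment1 : m 1 = 0.
Proof. by have := mS 0; rewrite /= expr0n mul0r expr1n mul1r. Qed.

(** For n = 2j + 1 this is E[U_(2j)] = E[c^j]. The recurrence for [chebV] has stride 4 and the one
    for [m] has stride 2, so four initial values suffice. *)
Lemma pmoment_chebV n : pmoment (chebV n) = if odd n then m n./2 else 0.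
Proof.
elim/ltn_ind: n => -[|[|[|[|n]]]] IH.
- by rewrite /chebV linear0.
- by rewrite chebVS /chebV /chebT/= mulr0 add0r -(expr0 'X) pmomentXn.
- have -> : chebV 2 = 2%:R *: 'X^1.
    by rewrite !chebVS chebTS /chebV /chebT/= scaler_nat -mulr_natl; ring.
  by rewrite linearZ/= pmomentXn moment1 /= mulr0.
- have -> : chebV 3 = 4%:R *: 'X^2 - 'X^0.
    by rewrite !chebVS !chebTS !chebVS /chebV /chebT/= scaler_nat -mulr_natl expr0; ring.
  rewrite linearB linearZ/= !pmomentXn.
  by have := mS 1; rewrite /= m0 moment1; lra.
- have := pmoment_chebV_rec n; rewrite (IH n) ?ltnS//; last by do 3 apply: ltnW.
  rewrite /= !negbK; case: ifP => [on|_] E.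
    have := mS (n./2.+1); rewrite /= => E2.
    have e : n = n./2.*2.+1 by rewrite -[LHS]odd_double_half on.
    move: E; rewrite {1 3}e => E.
    apply: (mulfI (_ : (n./2.*2.+1).+3%:R ^+ 2 != 0)).
      by rewrite expf_neq0// pnatr_eq0.
    rewrite E.
    (* For n = 2j + 1 both coefficients are squares of even numbers; up to the common factor 4 the
       recurrence is [mS] at j + 1. *)
    have -> : (n./2.*2.+1).+3 = (2 * n./2.+2)%N by rewrite mul2n !doubleS.
    have -> : (n./2.*2.+1).+1 = (2 * n./2.+1)%N by rewrite mul2n !doubleS.
    by rewrite !natrM !exprMn -[LHS]mulrA -[RHS]mulrA E2.
  move/eqP: E; rewrite mulr0 mulf_eq0 expf_eq0 /= pnatr_eq0 /=.
  by move/eqP.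
Qed.

Lemma moment_odd n : odd n -> m n = 0.
Proof.
elim/ltn_ind: n => -[|[|n]] IH //; first by rewrite moment1.
rewrite /= negbK => on; have := mS n.+1; rewrite /= (IH n)// mulr0 => /eqP.
by rewrite mulf_eq0 expf_eq0 /= pnatr_eq0 /= => /eqP.
Qed.

Lemma pmoment_chebT n : 2 * pmoment (chebT n.+1) =
  if odd n.+1 then 0 else m (n.+1)./2 - m (n.+1)./2.-1.
Proof.
have -> : 2 * pmoment (chebT n.+1) = pmoment (chebV n.+2) - pmoment (chebV n).
  by rewrite -linearB -chebT_chebV !mulr_natl linearMn.
rewrite !pmoment_chebV.
rewrite /= negbK uphalf_half; case: (odd n) => /=; last by rewrite subrr.
by rewrite add1n.
Qed.

End Chebyshev.

(** * Truncated logarithm *)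

Section LogSeries.
Variable R : realType.
Implicit Types (w z : R[i]) (r rho : R).

Lemma ReD w z : Re (w + z) = Re w + Re z.
Proof. by move: w z => [a b] [c d]. Qed.

Lemma ReN w : Re (- w) = - Re w.
Proof. by case: w. Qed.

Lemma ReZ r w : Re (r%:C%C * w) = r * Re w.
Proof. by case: w => a b /=; rewrite mul0r subr0. Qed.

Lemma Re_sum (I : Type) (s : seq I) (P : pred I) (F : I -> R[i]) :
  Re (\sum_(i <- s | P i) F i) = \sum_(i <- s | P i) Re (F i).
Proof. by apply: (big_morph (@Re R) ReD). Qed.

Lemma normc_ge0 z : 0 <= normc z.
Proof. by case: z => a b; apply: sqrtr_ge0. Qed.

Lemma sqr_normc z : normc z ^+ 2 = Re z ^+ 2 + Im z ^+ 2.
Proof. by case: z => a b /=; rewrite sqr_sqrtr// addr_ge0 ?sqr_ge0. Qed.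

Lemma normcX z n : normc (z ^+ n) = normc z ^+ n.
Proof. by elim: n => [|n IH]; rewrite ?expr0 ?Normc.normc1// !exprS Normc.normcM IH. Qed.

Lemma normc_real r : normc r%:C%C = `|r|.
Proof. by rewrite /= expr0n/= addr0 sqrtr_sqr. Qed.

Lemma ler_Re_normc z : `|Re z| <= normc z.
Proof.
rewrite -(@ler_pXn2r _ 2) ?nnegrE ?normc_ge0// sqr_normc real_normK ?num_real//.
by rewrite lerDl sqr_ge0.
Qed.

Lemma normc_1B_ge w : 1 - normc w <= normc (1 - w).
Proof.
have := @le_normcD R (1 - w) w; rewrite subrK Normc.normc1 => h.
by rewrite lerBlDr.
Qed.

Lemma normc_gt0 z : z != 0 -> 0 < normc z.
Proof.
move=> z0; rewrite lt_neqAle normc_ge0 andbT eq_sym.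
by apply: contra z0 => /eqP/Normc.eq0_normc->.
Qed.

Lemma subr1_neq0 w : normc w < 1 -> 1 - w != 0.
Proof.
move=> w1; have := normc_1B_ge w; apply: contraTneq => ->.
by rewrite Normc.normc0 -ltNge subr_gt0.
Qed.

(* Mean value theorem for r |-> ln|1 - r w| + partial sum, whose derivative is
   the real part of the geometric remainder - w (r w)^N / (1 - r w). *)
Lemma ler_ln_normc_trunc w rho N : normc w <= rho -> rho < 1 ->
  `| ln (normc (1 - w)) + \sum_(n < N) Re (w ^+ n.+1) / n.+1%:R |
    <= rho ^+ N.+1 / (1 - rho).
Proof.
move=> wr r1; have rho0 : 0 <= rho by apply: le_trans (normc_ge0 w) wr.
(* [q] is r |-> |1 - r w|^2, so ln|1 - r w| = ln(q(r)) / 2 can be differentiated by real calculus,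
   [q] being positive on [0, 1]. *)
pose q : {poly R} := 1 - (Re w *+ 2) *: 'X + (Re w ^+ 2 + Im w ^+ 2) *: 'X^2.
pose p : {poly R} := \sum_(n < N) (Re (w ^+ n.+1) / n.+1%:R) *: 'X^(n.+1).
have nw r : 0 <= r <= 1 -> normc (r%:C%C * w) <= rho.
  move=> /andP[r0 rl]; rewrite Normc.normcM normc_real ger0_norm//.
  by rewrite -[leRHS]mul1r ler_pM ?normc_ge0.
have rw1 r : 0 <= r <= 1 -> 1 - rho <= normc (1 - r%:C%C * w).
  by move=> rr; apply: le_trans (normc_1B_ge _); rewrite lerD2l lerN2 nw.
have rw0 r : 0 <= r <= 1 -> 1 - r%:C%C * w != 0.
  move=> /rw1 h; apply/eqP => e; move: h; rewrite e Normc.normc0; lra.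
have qE r : q.[r] = normc (1 - r%:C%C * w) ^+ 2.
  rewrite sqr_normc /q !hornerE/=.
  by case: w {wr p nw rw1 rw0 q} => x y /=; ring.
have q0 r : 0 <= r <= 1 -> 0 < q.[r].
  by move=> /rw1 h; rewrite qE exprn_gt0//; lra.
pose g r := ln q.[r] / 2 + p.[r].
pose dg r := (deriv q).[r] / q.[r] / 2 + (deriv p).[r].
have dgP r : 0 <= r <= 1 -> is_derive r 1 g (dg r).
  move=> rr; have := is_derive1_comp (is_derive1_ln (q0 r rr)) (is_derive_poly q r).
  move=> d1; have d2 := is_derive_poly p r.
  pose f := ((2^-1 : R) *: (@ln R \o horner q)) + horner p.
  have -> : g = f by apply/funext => s; rewrite /g /f !fctE /= mulrC.
  have d3 : is_derive r 1 f ((2^-1 : R) *: (q.[r]^-1 * (deriv q).[r]) + (deriv p).[r]).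
    exact: is_deriveD.
  apply: is_derive_eq d3 _.
  by rewrite /dg /GRing.scale/=; ring.
have dgE r : 0 <= r <= 1 -> dg r =
    Re (- (w * (r%:C%C * w) ^+ N / (1 - r%:C%C * w))).
  move=> rr; set W := r%:C%C * w; have W0 := rw0 r rr; rewrite -/W in W0.
  (* A finite geometric sum: the real part of - w / (1 - W) comes from the logarithm, that of the
     sum from [p]. *)
  have -> : - (w * W ^+ N / (1 - W)) =
     - (w / (1 - W)) + \sum_(n < N) (r ^+ n)%:C%C * w ^+ n.+1.
    have -> : \sum_(n < N) (r ^+ n)%:C%C * w ^+ n.+1 = w * ((1 - W ^+ N) / (1 - W)).
      rewrite -opprB subrX1 -mulNr opprB (mulrC (1 - W)) mulfK// mulr_sumr.
      by apply: eq_bigr => n _; rewrite exprMn rmorphXn/= exprS mulrCA.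
    by field.
  rewrite ReD Re_sum /dg; congr (_ + _).
    have qr0 : q.[r] != 0 by rewrite gt_eqF ?q0.
    rewrite qE sqr_normc in qr0 *.
    have -> : deriv q = - (Re w *+ 2)%:P + (Re w ^+ 2 + Im w ^+ 2) *: ('X *+ 2).
      by rewrite /q derivD derivB -polyC1 derivC !derivZ derivX derivXn sub0r alg_polyC.
    rewrite !hornerE /=.
    move: qr0 W0; rewrite /W; case: w {wr p g dg dgP q qE q0 nw rw1 rw0 W rr} => x y /=.
    rewrite !mul0r !subr0 !addr0.
    set d := (_ ^+ 2 + _) => qr0 W0; by field.
  rewrite /p linear_sum horner_sum; apply: eq_bigr => n _.
  rewrite /= derivZ derivXn hornerZ hornerMn hornerXn ReZ -[r ^+ _ *+ _]mulr_natr.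
  by field; rewrite nat1r pnatr_eq0.
have dg_le r : 0 <= r <= 1 -> `|dg r| <= rho ^+ N.+1 / (1 - rho).
  move=> rr; rewrite dgE//; apply: le_trans (ler_Re_normc _) _.
  rewrite normcN !Normc.normcM Normc.normcV normcX exprS.
  apply: ler_pM; rewrite ?invr_ge0 ?normc_ge0 ?mulr_ge0 ?exprn_ge0 ?normc_ge0//.
    by rewrite ler_pM ?exprn_ge0 ?normc_ge0// lerXn2r ?nnegrE ?normc_ge0 ?nw.
  have h := rw1 r rr; rewrite lef_pV2 ?posrE; lra.
have [||c + E] := @MVT R g dg 0 1 ltr01.
- by move=> r; rewrite in_itv/= => /andP[r0 rl]; apply: dgP; rewrite !ltW.
- apply: derivable_within_continuous => r; rewrite in_itv/= => rr.
  by have [] := dgP r rr.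
rewrite in_itv/= => /andP[c0 c1].
move: E; rewrite subr0 mulr1 /g.
have -> : ln q.[0] / 2 + p.[0] = 0.
  rewrite qE mul0r subr0 Normc.normc1 expr1n ln1 mul0r add0r /p horner_sum big1// => n _.
  by rewrite !hornerE/= expr0n/= mulr0.
have -> : ln q.[1] / 2 = ln (normc (1 - w)).
  rewrite qE mul1r lnXn; first by rewrite mulr2n; field.
  by have := rw1 1; rewrite mul1r ler01 lexx => /(_ isT); lra.
have -> : p.[1] = \sum_(n < N) Re (w ^+ n.+1) / n.+1%:R.
  by rewrite /p horner_sum; apply: eq_bigr => n _; rewrite !hornerE/= expr1n mulr1.
by rewrite subr0 => ->; apply: dg_le; rewrite !ltW.
Qed.

End LogSeries.

Local Open Scope classical_set_scope.

(** * Integrals over the torus *)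

Section TorusIntegral.
Variable R : realType.

Local Notation leb := (@lebesgue_measure R).
Local Notation leb2 := (leb \x leb)%E.
Local Notation I01 := (`[0%R, 1%R] : set R).
Local Notation I2 := (I01 `*` I01).

Lemma lebesgue_square : leb2 I2 = 1%E.
Proof.
have I1 : leb I01 = 1%E.
  by rewrite lebesgue_measure_itv/= lte_fin ltr01 oppr0 adde0.
by rewrite [LHS]product_measure1E//; rewrite -[RHS]mule1; congr (_ * _)%E.
Qed.

Lemma bounded_integrable_square (f : R * R -> R) M :
  measurable_fun setT f -> (forall t, `|f t| <= M) ->
  leb2.-integrable I2 (EFin \o f).
Proof.
move=> mf fM; apply: measurable_bounded_integrable.
- exact: measurableX.
- by rewrite [X in (X < _)%E]lebesgue_square ltry.
- exact: measurable_funTS.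
- by exists M; split; rewrite ?num_real// => x Mx t _; apply: le_trans (fM t) (ltW Mx).
Qed.

(** Fubini on the whole plane, applied to the extension of [f] by zero outside the square. *)
Lemma integral_square12 (f : R * R -> R) :
  leb2.-integrable I2 (EFin \o f) ->
  (\int[leb2]_(t in I2) (f t)%:E =
   \int[leb]_(x in I01) \int[leb]_(y in I01) (f (x, y))%:E)%E.
Proof.
move=> fi0; have fi : leb2.-integrable setT ((EFin \o f) \_ I2).
  by apply: (iffLR (integrable_mkcond _ _)) fi0; exact: measurableX.
rewrite integral_mkcond -(integral12_prod_meas1 fi) [RHS]integral_mkcond.
apply: eq_integral => x _; rewrite patchE; case: ifPn => xI.
  rewrite [RHS]integral_mkcond; apply: eq_integral => y _.
  by rewrite !patchE in_setX xI.
by apply: integral0_eq => y _; rewrite patchE in_setX (negbTE xI).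
Qed.

Lemma integral_square21 (f : R * R -> R) :
  leb2.-integrable I2 (EFin \o f) ->
  (\int[leb2]_(t in I2) (f t)%:E =
   \int[leb]_(y in I01) \int[leb]_(x in I01) (f (x, y))%:E)%E.
Proof.
move=> fi0; have fi : leb2.-integrable setT ((EFin \o f) \_ I2).
  by apply: (iffLR (integrable_mkcond _ _)) fi0; exact: measurableX.
rewrite integral_mkcond -(integral21_prod_meas1 fi) [RHS]integral_mkcond.
apply: eq_integral => y _; rewrite patchE; case: ifPn => yI.
  rewrite [RHS]integral_mkcond; apply: eq_integral => x _.
  by rewrite !patchE in_setX yI andbT.
by apply: integral0_eq => x _; rewrite patchE in_setX (negbTE yI) andbF.
Qed.

Lemma integral_derive_periodic (F f : R -> R) :
  (forall t : R, is_derive t 1 F (f t)) -> continuous f -> F 0 = F 1 ->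
  (\int[leb]_(x in I01) (f x)%:E = 0)%E.
Proof.
move=> dF cf F01.
have cF : continuous F.
  by move=> t; apply/differentiable_continuous/derivable1_diffP; have [] := dF t.
rewrite (@continuous_FTC2 _ f F 0 1)//.
- by rewrite F01 subee.
- exact: continuous_subspaceT.
- split.
  + by move=> x _; have [] := dF x.
  + exact: cvg_at_right_filter (cF 0).
  + exact: cvg_at_left_filter (cF 1).
- by move=> x _; rewrite derive1E; have [_] := dF x.
Qed.

Definition ucos (t : R) := cos (2 * pi * t).
Definition usin (t : R) := sin (2 * pi * t).

Lemma is_derive_ucos (t : R) : is_derive t 1 ucos (- (2 * pi * usin t)).
Proof.
have d : is_derive t 1 ( *%R (2 * pi : R)) (2 * pi).
  have -> : *%R (2 * pi : R) = (2 * pi : R) *: id by [].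
  by apply: is_derive_eq; rewrite /GRing.scale/= mulr1.
have := is_derive1_comp (is_derive_cos (2 * pi * t)) d.
by move=> h; apply: is_derive_eq h _; rewrite mulNr mulrC.
Qed.

Lemma is_derive_usin (t : R) : is_derive t 1 usin (2 * pi * ucos t).
Proof.
have d : is_derive t 1 ( *%R (2 * pi : R)) (2 * pi).
  have -> : *%R (2 * pi : R) = (2 * pi : R) *: id by [].
  by apply: is_derive_eq; rewrite /GRing.scale/= mulr1.
have := is_derive1_comp (is_derive_sin (2 * pi * t)) d.
by move=> h; apply: is_derive_eq h _; rewrite mulrC.
Qed.

Lemma continuous_ucos : continuous ucos.
Proof.
move=> t; apply/differentiable_continuous/derivable1_diffP.
by have [] := is_derive_ucos t.
Qed.

Lemma continuous_usin : continuous usin.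
Proof.
move=> t; apply/differentiable_continuous/derivable1_diffP.
by have [] := is_derive_usin t.
Qed.

Lemma ucos01 : ucos 0 = ucos 1.
Proof. by rewrite /ucos mulr0 mulr1 cos0 mulr_natl cos2pi. Qed.

Lemma usin01 : usin 0 = usin 1.
Proof. by rewrite /usin mulr0 mulr1 sin0 mulr_natl sin2pi. Qed.

End TorusIntegral.

(** * Moments of the averaged cosine on the torus *)

Section TorusMoments.
Variable R : realType.

Local Notation leb := (@lebesgue_measure R).
Local Notation leb2 := (leb \x leb)%E.
Local Notation I01 := (`[0%R, 1%R] : set R).
Local Notation I2 := (I01 `*` I01).

(** A class closed under ring operations on which the torus mean is linear. Bounding on the whole
    plane costs nothing for the periodic functions at hand. *)
Definition bounded_measurable (f : R * R -> R) :=
  measurable_fun setT f /\ exists M, forall t, `|f t| <= M.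

Lemma bounded_measurable_integrable f : bounded_measurable f ->
  leb2.-integrable I2 (EFin \o f).
Proof. by move=> [mf [M fM]]; exact: bounded_integrable_square fM. Qed.

Lemma bounded_measurable_cst c : bounded_measurable (fun=> c).
Proof. by split; [exact: measurable_cst | exists `|c|]. Qed.

Lemma bounded_measurableD f g : bounded_measurable f -> bounded_measurable g ->
  bounded_measurable (fun t => f t + g t).
Proof.
move=> [mf [M fM]] [mg [K gK]]; split; first exact: measurable_funD.
by exists (M + K) => t; apply: le_trans (ler_normD _ _) _; rewrite lerD.
Qed.

Lemma bounded_measurableM f g : bounded_measurable f -> bounded_measurable g ->
  bounded_measurable (fun t => f t * g t).
Proof.
move=> [mf [M fM]] [mg [K gK]]; split; first exact: measurable_funM.
by exists (M * K) => t; rewrite normrM ler_pM.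
Qed.

Lemma bounded_measurableN f : bounded_measurable f ->
  bounded_measurable (fun t => - f t).
Proof.
move=> [mf [M fM]]; split; first exact: measurable_funN.
by exists M => t; rewrite normrN.
Qed.

Lemma bounded_measurableX f n : bounded_measurable f ->
  bounded_measurable (fun t => f t ^+ n).
Proof.
move=> [mf [M fM]]; split; first exact: measurable_funX.
exists (M ^+ n) => t; rewrite normrX lerXn2r// nnegrE.
exact: le_trans (fM t).
Qed.

Lemma bounded_measurable_fst (h : R -> R) M : continuous h ->
  (forall t, `|h t| <= M) -> bounded_measurable (fun t => h t.1).
Proof.
move=> ch hM; split; last by exists M.
by apply: measurableT_comp => //; exact: continuous_measurable_fun.
Qed.

Lemma bounded_measurable_snd (h : R -> R) M : continuous h ->
  (forall t, `|h t| <= M) -> bounded_measurable (fun t => h t.2).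
Proof.
move=> ch hM; split; last by exists M.
by apply: measurableT_comp => //; exact: continuous_measurable_fun.
Qed.

Lemma normr_ucos_le1 (t : R) : `|ucos t| <= 1.
Proof. by rewrite ler_norml cos_geN1 cos_le1. Qed.

Lemma normr_usin_le1 (t : R) : `|usin t| <= 1.
Proof. by rewrite ler_norml sin_geN1 sin_le1. Qed.

Definition bounded_measurable_ucos :=
  (bounded_measurable_fst (@continuous_ucos R) normr_ucos_le1,
   bounded_measurable_snd (@continuous_ucos R) normr_ucos_le1).

Definition bounded_measurable_usin :=
  (bounded_measurable_fst (@continuous_usin R) normr_usin_le1,
   bounded_measurable_snd (@continuous_usin R) normr_usin_le1).

Ltac bounded_measurable_tac := repeat first
  [ exact: bounded_measurable_ucos.1 | exact: bounded_measurable_ucos.2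
  | exact: bounded_measurable_usin.1 | exact: bounded_measurable_usin.2
  | exact: bounded_measurable_cst
  | apply: bounded_measurableD | apply: bounded_measurableM
  | apply: bounded_measurableN | apply: bounded_measurableX ].

(* In the variables u = (a + b) / 2, v = (a - b) / 2 one has c = cos u cos v, and
   (j+1)^2 c^(j+1) - j^2 c^(j-1) is the u-derivative of (j+1) c^j sin u cos v plus
   the v-derivative of j c^(j-1) sin v cos v.  [flux] collects the terms
   differentiated in a; those differentiated in b follow by swapping a and b. *)
Definition flux j (ca sa cb sb : R) : R :=
  j.+1%:R * (((ca + cb) / 2) ^+ j * ((sa + sb) / 2)) +
  j%:R * (((ca + cb) / 2) ^+ j.-1 * ((sa * cb - ca * sb) / 2)).

Definition dflux j (ca sa cb sb : R) : R :=
  j.+1%:R * (((ca + cb) / 2) ^+ j * (ca / 2)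
    - j%:R * ((ca + cb) / 2) ^+ j.-1 * (sa / 2) * ((sa + sb) / 2)) +
  j%:R * (((ca + cb) / 2) ^+ j.-1 * ((ca * cb + sa * sb) / 2)
    - j.-1%:R * ((ca + cb) / 2) ^+ j.-2 * (sa / 2) * ((sa * cb - ca * sb) / 2)).

Lemma dflux_sym j (ca sa cb sb : R) :
  ca ^+ 2 + sa ^+ 2 = 1 -> cb ^+ 2 + sb ^+ 2 = 1 ->
  dflux j ca sa cb sb + dflux j cb sb ca sa =
  j.+1%:R ^+ 2 * ((ca + cb) / 2) ^+ j.+1 - j%:R ^+ 2 * ((ca + cb) / 2) ^+ j.-1.
Proof.
move=> ha hb.
have {}ha : sa ^+ 2 = 1 - ca ^+ 2 by rewrite -ha; ring.
have {}hb : sb ^+ 2 = 1 - cb ^+ 2 by rewrite -hb; ring.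
(* The predecessors of j truncate at j = 0 and j = 1, which are therefore treated apart. *)
rewrite /dflux (addrC cb ca) (addrC sb sa); case: j => [|[|j]] /=.
- by field.
- by field: ha hb.
(* Eliminating [ca] makes the average an atom [x], so that all powers reduce to multiples of x^j. *)
- set x := (ca + cb) / 2; have cax : ca = 2 * x - cb by rewrite /x; field.
  clearbody x; subst ca; rewrite !(exprS _ j.+2) !(exprS _ j.+1) !(exprS x j).
  by field: ha hb.
Qed.

Lemma is_derive_flux j (cb sb t : R) :
  is_derive t 1 (fun t => flux j (ucos t) (usin t) cb sb)
    (2 * pi * dflux j (ucos t) (usin t) cb sb).
Proof.
pose c : R -> R := (2^-1 : R) *: (@ucos R + cst cb).
pose p : R -> R := (2^-1 : R) *: (@usin R + cst sb).
pose q : R -> R := (2^-1 : R) *: (cb *: @usin R - sb *: @ucos R).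
have dc0 := is_derive_ucos t; have ds0 := is_derive_usin t.
have dc : is_derive t 1 c (- pi * usin t).
  by apply: is_derive_eq; rewrite /GRing.scale/=; field.
have dp : is_derive t 1 p (pi * ucos t).
  by apply: is_derive_eq; rewrite /GRing.scale/=; field.
have dq : is_derive t 1 q (pi * (ucos t * cb + usin t * sb)).
  by apply: is_derive_eq; rewrite /GRing.scale/=; field.
have cE s : c s = (ucos s + cb) / 2 by rewrite /c mulrC.
have pE s : p s = (usin s + sb) / 2 by rewrite /p mulrC.
have qE s : q s = (usin s * cb - ucos s * sb) / 2.
  by rewrite /q mulrC !fctE /GRing.scale/= (mulrC cb) (mulrC sb).
clearbody c p q.
have -> : (fun t => flux j (ucos t) (usin t) cb sb) =
    (j.+1%:R : R) *: (c ^+ j * p) + (j%:R : R) *: (c ^+ j.-1 * q).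
  by apply/funext => s; rewrite !fctE cE pE qE.
have dj n := is_deriveX n dc.
have d1 := is_deriveZ (j.+1%:R : R) (is_deriveM (dj j) dp).
have d2 := is_deriveZ (j%:R : R) (is_deriveM (dj j.-1) dq).
apply: is_derive_eq (is_deriveD d1 d2) _.
rewrite !fctE cE pE qE /dflux /GRing.scale/=.
by case: j {dj d1 d2} => [|[|j]] /=; field.
Qed.

Lemma continuous_ucosDX (cb : R) n :
  continuous (fun t => ((ucos t + cb) / 2) ^+ n).
Proof.
move=> t; apply: (@continuous_comp _ _ _ (fun t => (ucos t + cb) / 2)
  (fun x => x ^+ n)); last exact: exprn_continuous.
apply: cvgM; last exact: cvg_cst.
by apply: cvgD; [exact: continuous_ucos | exact: cvg_cst].
Qed.

Lemma continuous_dflux j (cb sb : R) :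
  continuous (fun t => dflux j (ucos t) (usin t) cb sb).
Proof.
move=> t; rewrite /dflux.
have cc := @continuous_ucos R t; have cs := @continuous_usin R t.
have cX n := @continuous_ucosDX cb n t.
have k (a : R) : (fun=> a) x @[x --> t] --> a by exact: cvg_cst.
apply: cvgD.
  apply: cvgM; first exact: k.
  apply: cvgB; first by apply: cvgM (cX j) _; exact: cvgM cc (k _).
  apply: cvgM; last by apply: cvgM; [exact: cvgD cs (k _) | exact: k].
  by apply: cvgM; [exact: cvgM (k _) (cX _) | exact: cvgM cs (k _)].
apply: cvgM; first exact: k.
apply: cvgB.
  apply: cvgM (cX j.-1) _; apply: cvgM; last exact: k.
  by apply: cvgD; [exact: cvgM cc (k _) | exact: cvgM cs (k _)].
apply: cvgM.
  by apply: cvgM; [exact: cvgM (k _) (cX _) | exact: cvgM cs (k _)].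
apply: cvgM; last exact: k.
by apply: cvgB; [exact: cvgM cs (k _) | exact: cvgM cc (k _)].
Qed.

Lemma bounded_measurable_dflux j : bounded_measurable
  (fun t => dflux j (ucos t.1) (usin t.1) (ucos t.2) (usin t.2)).
Proof. by rewrite /dflux; bounded_measurable_tac. Qed.

Lemma bounded_measurable_dflux_swap j : bounded_measurable
  (fun t => dflux j (ucos t.2) (usin t.2) (ucos t.1) (usin t.1)).
Proof. by rewrite /dflux; bounded_measurable_tac. Qed.

(** With the other angle fixed, [flux] divided by 2 pi is a 1-periodic antiderivative. *)
Lemma integral_dflux j cb sb :
  (\int[leb]_(x in I01) (dflux j (ucos x) (usin x) cb sb)%:E = 0)%E.
Proof.
have pi2 : (2 * pi : R) != 0 by rewrite mulf_neq0 ?pnatr_eq0 ?gt_eqF ?pi_gt0.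
pose F : R -> R := (2 * pi : R)^-1 *: (fun t => flux j (ucos t) (usin t) cb sb).
apply: (@integral_derive_periodic R F
  (fun t => dflux j (ucos t) (usin t) cb sb)).
- move=> t; have d := is_deriveZ (2 * pi : R)^-1 (is_derive_flux j cb sb t).
  by apply: is_derive_eq d _; rewrite /GRing.scale/= mulKf.
- exact: continuous_dflux.
- by rewrite /F !fctE ucos01 usin01.
Qed.

Definition uavg (t : R * R) := (ucos t.1 + ucos t.2) / 2.

Definition torus_mean (f : R * R -> R) : R := \int[leb2]_(t in I2) f t.

Lemma bounded_measurable_uavg : bounded_measurable uavg.
Proof. by rewrite /uavg; bounded_measurable_tac. Qed.

Lemma torus_meanD f g : bounded_measurable f -> bounded_measurable g ->
  torus_mean (fun t => f t + g t) = torus_mean f + torus_mean g.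
Proof.
move=> bf bg; rewrite /torus_mean RintegralD//; last 2 first.
- exact: bounded_measurable_integrable.
- exact: bounded_measurable_integrable.
exact: measurableX.
Qed.

Lemma torus_meanZ r f : bounded_measurable f ->
  torus_mean (fun t => r * f t) = r * torus_mean f.
Proof.
move=> bf; rewrite /torus_mean RintegralZl//.
- exact: measurableX.
- exact: bounded_measurable_integrable.
Qed.

Lemma torus_mean_cst r : torus_mean (fun=> r) = r.
Proof.
rewrite /torus_mean Rintegral_cst; last exact: measurableX.
by rewrite [X in fine X]lebesgue_square mulr1.
Qed.

Lemma ler_norm_torus_mean f M : bounded_measurable f ->
  (forall t, `|f t| <= M) -> `|torus_mean f| <= M.
Proof.
move=> bf fM; have fi := bounded_measurable_integrable bf.
apply: (@le_trans _ _ (torus_mean (fun t => `|f t|))).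
  by apply: le_normr_Rintegral => //; exact: measurableX.
rewrite -[leRHS]torus_mean_cst; apply: le_Rintegral => //.
- exact: measurableX.
- exact: integrable_norm.
- by apply: bounded_measurable_integrable; exact: bounded_measurable_cst.
Qed.

Definition uavg_moment n := torus_mean (fun t => uavg t ^+ n).

Lemma uavg_moment0 : uavg_moment 0 = 1.
Proof. exact: torus_mean_cst. Qed.

(** Integration by parts on the torus: by [dflux_sym], the difference of the two sides is the mean
    of a divergence. *)
Lemma uavg_momentS j :
  j.+1%:R ^+ 2 * uavg_moment j.+1 = j%:R ^+ 2 * uavg_moment j.-1.
Proof.
have bu n : bounded_measurable (fun t => uavg t ^+ n).
  exact/bounded_measurableX/bounded_measurable_uavg.
have bd1 := bounded_measurable_dflux j.
have bd2 := bounded_measurable_dflux_swap j.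
apply/eqP; rewrite -subr_eq0 -!torus_meanZ// -mulN1r -torus_meanZ; last first.
  by apply: bounded_measurableM => //; exact: bounded_measurable_cst.
rewrite -torus_meanD; last 2 first.
- by apply: bounded_measurableM => //; exact: bounded_measurable_cst.
- by do 2 (apply: bounded_measurableM; first exact: bounded_measurable_cst).
rewrite (_ : (fun _ => _) = fun t =>
    dflux j (ucos t.1) (usin t.1) (ucos t.2) (usin t.2) +
    dflux j (ucos t.2) (usin t.2) (ucos t.1) (usin t.1)); last first.
  by apply/funext => t; rewrite dflux_sym ?cos2Dsin2// mulN1r.
rewrite torus_meanD// /torus_mean /Rintegral.
(* Each summand is integrated first in the variable in which it is a derivative. The two iterated
   integrals then agree up to renaming, and both vanish at once. *)
rewrite (integral_square21 (bounded_measurable_integrable bd1)).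
rewrite (integral_square12 (bounded_measurable_integrable bd2)) /=.
rewrite integral0_eq; last by move=> y _; rewrite integral_dflux.
by rewrite addr0.
Qed.

End TorusMoments.

(** * Truncated logarithms in terms of moments *)

Section LogMoments.
Variable R : realType.
Implicit Types (k : R[i]) (c s rho : R) (p : {poly R}).

(** De Moivre's formula for a point of the unit circle given by its coordinates. *)
Lemma Complex_exp_chebyshev c s n : c ^+ 2 + s ^+ 2 = 1 ->
  Complex c s ^+ n = Complex (chebT R n).[c] (s * (chebV R n).[c]).
Proof.
move=> cs; elim: n => [|n IH].
  by rewrite expr0 /chebT /chebV /= !hornerE.
rewrite exprS IH chebTS chebVS !hornerE/=; apply/eqP; rewrite eq_complex /=.
have -> : 1 - c ^+ 2 = s ^+ 2 by rewrite -cs; ring.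
by apply/andP; split; apply/eqP; ring.
Qed.

Lemma normc_unit c s : c ^+ 2 + s ^+ 2 = 1 -> normc (Complex c s) = 1.
Proof. by move=> /= ->; rewrite sqrtr1. Qed.

Lemma quadratic_factor k c s : c ^+ 2 + s ^+ 2 = 1 ->
  1 + k ^+ 2 + 2 * k * c%:C%C =
  (1 - - k * Complex c s) * (1 - - k * Complex c (- s)).
Proof.
move=> cs; set e := Complex c s; set e' := Complex c (- s).
have ee' : e * e' = 1.
  by apply/eqP; rewrite eq_complex/=; apply/andP; split; apply/eqP; rewrite -?cs; ring.
have eDe' : e + e' = 2 * c%:C%C.
  by apply/eqP; rewrite eq_complex/=; apply/andP; split; apply/eqP; ring.
transitivity (1 + k ^+ 2 * (e * e') + k * (e + e')); last by ring.
by rewrite ee' eDe'; ring.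
Qed.

Lemma circle_sqrt c : `|c| <= 1 -> c ^+ 2 + Num.sqrt (1 - c ^+ 2) ^+ 2 = 1.
Proof.
move=> c1; have c2 : c ^+ 2 <= 1 by rewrite -real_normK ?num_real// expr_le1.
by rewrite sqr_sqrtr ?subr_ge0// addrC subrK.
Qed.

Lemma quadratic_neq0 k c : `|c| <= 1 -> normc k < 1 ->
  1 + k ^+ 2 + 2 * k * c%:C%C != 0.
Proof.
move=> /circle_sqrt cs k1; rewrite (quadratic_factor k cs).
have cs' : c ^+ 2 + (- Num.sqrt (1 - c ^+ 2)) ^+ 2 = 1 by rewrite sqrrN.
by rewrite mulf_neq0// subr1_neq0// Normc.normcM normc_unit// mulr1 normcN.
Qed.

Lemma linear_neq0 k c : `|c| <= 1 -> normc k < 1 -> 1 + k * c%:C%C != 0.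
Proof.
move=> c1 k1; rewrite -[k * _]opprK subr1_neq0// normcN Normc.normcM normc_real.
by apply: le_lt_trans k1; rewrite ler_piMr ?normc_ge0.
Qed.

Lemma ler_ln_normc_chebyshev k c rho N : `|c| <= 1 -> normc k <= rho -> rho < 1 ->
  `| ln (normc (1 + k ^+ 2 + 2 * k * c%:C%C)) +
     \sum_(n < N) 2 * (Re ((- k) ^+ n.+1) / n.+1%:R) * (chebT R n.+1).[c] |
  <= 2 * (rho ^+ N.+1 / (1 - rho)).
Proof.
move=> /circle_sqrt cs kr r1; rewrite (quadratic_factor k cs).
move: (Num.sqrt _) cs => s cs.
have cs' : c ^+ 2 + (- s) ^+ 2 = 1 by rewrite sqrrN.
have nw x y : x ^+ 2 + y ^+ 2 = 1 -> normc (- k * Complex x y) <= rho.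
  by move=> xy; rewrite Normc.normcM normc_unit// mulr1 normcN.
have pos x y : x ^+ 2 + y ^+ 2 = 1 -> 0 < normc (1 - (- k * Complex x y)).
  by move=> xy; apply/normc_gt0/subr1_neq0; exact: le_lt_trans (nw _ _ xy) r1.
rewrite Normc.normcM lnM ?posrE ?pos//.
have h := ler_ln_normc_trunc N (nw _ _ cs) r1.
have h' := ler_ln_normc_trunc N (nw _ _ cs') r1.
(* The powers of e and its conjugate share the real part T_n(c) and have opposite imaginary parts,
   which cancel in the sum. *)
have -> : \sum_(n < N) 2 * (Re ((- k) ^+ n.+1) / n.+1%:R) * (chebT R n.+1).[c] =
    \sum_(n < N) Re ((- k * Complex c s) ^+ n.+1) / n.+1%:R +
    \sum_(n < N) Re ((- k * Complex c (- s)) ^+ n.+1) / n.+1%:R.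
  rewrite -big_split; apply: eq_bigr => n _ /=.
  rewrite !exprMn !Complex_exp_chebyshev//.
  by case: ((- k) ^+ n.+1) => a b /=; field; rewrite nat1r pnatr_eq0.
rewrite addrACA; apply: le_trans (ler_normD _ _) _.
by rewrite mulr_natl mulr2n lerD.
Qed.

(** Up to sign, the truncations in k of ln|1 + kc| ([logser]) and of ln|1 + k^2 + 2kc| ([chebser]),
    as polynomials in c. *)
Definition logser k N : {poly R} :=
  \sum_(n < N) (Re ((- k) ^+ n.+1) / n.+1%:R) *: 'X^(n.+1).

Definition chebser k N : {poly R} :=
  \sum_(n < N) (2 * (Re ((- k) ^+ n.+1) / n.+1%:R)) *: chebT R n.+1.

Lemma ler_ln_normc_logser k c rho N : `|c| <= 1 -> normc k <= rho -> rho < 1 ->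
  `| ln (normc (1 + k * c%:C%C)) + (logser k N).[c] | <= rho ^+ N.+1 / (1 - rho).
Proof.
move=> c1 kr r1.
have wr : normc (- k * c%:C%C) <= rho.
  rewrite Normc.normcM normcN normc_real -[leRHS]mulr1.
  by rewrite ler_pM ?normc_ge0.
have := ler_ln_normc_trunc N wr r1.
rewrite mulNr opprK; congr (`|_ + _| <= _).
rewrite /logser horner_sum; apply: eq_bigr => n _.
rewrite -mulNr exprMn -rmorphXn/= [(- k) ^+ _ * _]mulrC ReZ !hornerE/=; field.
by rewrite nat1r pnatr_eq0.
Qed.

Lemma ler_ln_normc_chebser k c rho N : `|c| <= 1 -> normc k <= rho -> rho < 1 ->
  `| ln (normc (1 + k ^+ 2 + 2 * k * c%:C%C)) + (chebser k N).[c] |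
  <= 2 * (rho ^+ N.+1 / (1 - rho)).
Proof.
move=> c1 kr r1; have := ler_ln_normc_chebyshev N c1 kr r1.
congr (`|_ + _| <= _); rewrite /chebser horner_sum; apply: eq_bigr => n _.
by rewrite hornerZ.
Qed.

Variable m : nat -> R.
Hypothesis m0 : m 0 = 1.
Hypothesis mS : forall j, (j.+1)%:R ^+ 2 * m j.+1 = j%:R ^+ 2 * m j.-1.

Lemma pmoment_logserS k N : pmoment m (logser k N.+1) =
  pmoment m (logser k N) + Re ((- k) ^+ N.+1) / N.+1%:R * m N.+1.
Proof. by rewrite {1}/logser big_ord_recr linearD linearZ /= pmomentXn. Qed.

Lemma pmoment_chebserS k N : pmoment m (chebser k N.+1) =
  pmoment m (chebser k N) +
  2 * (Re ((- k) ^+ N.+1) / N.+1%:R) * pmoment m (chebT R N.+1).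
Proof. by rewrite {1}/chebser big_ord_recr linearD linearZ. Qed.

(** The identity already holds exactly for truncations: degree N in k^2 matches degree 2N in k. Each
    induction step adds one term on the left and two terms to each series on the right, the odd ones
    having mean zero. *)
Lemma pmoment_logser k N :
  pmoment m (logser (k ^+ 2) N) =
  pmoment m (chebser k N.*2) + pmoment m (chebser ('i%C * k) N.*2).
Proof.
elim: N => [|N IH]; first by rewrite /logser /chebser !big_ord0 !linear0 addr0.
rewrite doubleS pmoment_logserS !pmoment_chebserS IH.
have T1 := pmoment_chebT m0 mS N.*2; have T2 := pmoment_chebT m0 mS N.*2.+1.
rewrite /= !odd_double /= in T1 T2.
have {}T1 : pmoment m (chebT R N.*2.+1) = 0.
  by move/eqP: T1; rewrite mulf_eq0 pnatr_eq0 => /eqP.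
rewrite T1 doubleK in T2 *.
move: (pmoment m (chebser k _)) (pmoment m (chebser ('i%C * k) _)) => A B.
move: (Re ((- k) ^+ N.*2.+1)) (Re ((- ('i%C * k)) ^+ N.*2.+1)) => z1 z2.
set a := pmoment m (chebT R N.*2.+2) in T2 *.
have -> : (- k) ^+ N.*2.+2 = (k ^+ 2) ^+ N.+1.
  by rewrite -doubleS -mul2n exprM sqrrN.
have -> : (- ('i%C * k)) ^+ N.*2.+2 = (- k ^+ 2) ^+ N.+1.
  by rewrite -doubleS -mul2n exprM sqrrN [('i%C * k) ^+ 2]exprMn sqr_i mulN1r.
rewrite [(- k ^+ 2) ^+ _]exprNn.
set z := (k ^+ 2) ^+ N.+1.
have d : (N.*2.+2%:R : R) = 2 * N.+1%:R by rewrite -doubleS -mul2n natrM.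
rewrite d.
have nz2 : (N.*2.+1%:R : R) != 0 by rewrite pnatr_eq0.
move: (N.*2.+1%:R : R) nz2 => d2 nz2.
have nz : (N.+1%:R : R) != 0 by rewrite pnatr_eq0.
move: (N.+1%:R : R) nz => d1 nz.
have aE : a = (m N.+1 - m N) / 2 by rewrite -T2; field.
(* For N odd, the terms of k and ik are equal and m_N = 0. For N even they cancel, and the left-hand
   term vanishes since m_(N+1) = 0. *)
rewrite aE -signr_odd /=; case: (boolP (odd N)) => oN /=; rewrite ?expr1 ?expr0.
  by rewrite mul1r (moment_odd mS oN); field; rewrite nz nz2.
have -> : Re (-1 * z) = - Re z by rewrite -ReN; congr Re; exact: mulN1r.
by rewrite (moment_odd (n:=N.+1) mS)//; field; rewrite nz nz2.
Qed.

End LogMoments.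

(** * Torus means of the logarithms and Mahler measures *)

Section MahlerMeasure.
Variable R : realType.
Implicit Types (a b k : R[i]) (rho : R) (p : {poly R}) (t : R * R).

Local Notation leb := (@lebesgue_measure R).
Local Notation leb2 := (leb \x leb)%E.
Local Notation I01 := (`[0%R, 1%R] : set R).
Local Notation I2 := (I01 `*` I01).

Lemma normr_uavg_le1 t : `|uavg t| <= 1.
Proof.
have := normr_ucos_le1 t.1; have := normr_ucos_le1 t.2.
by rewrite /uavg !ler_norml => /andP[? ?] /andP[? ?]; apply/andP; split; lra.
Qed.

Lemma bounded_measurable_horner p : bounded_measurable (fun t => p.[uavg t]).
Proof.
have bu := bounded_measurable_uavg R.
elim/poly_ind: p => [|p c IH].
  by rewrite (_ : (fun _ => _) = fun=> 0); [exact: bounded_measurable_cst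
    | apply/funext => t; rewrite horner0].
rewrite (_ : (fun _ => _) = fun t => p.[uavg t] * uavg t + c); last first.
  by apply/funext => t; rewrite !hornerE.
apply: bounded_measurableD; last exact: bounded_measurable_cst.
exact: bounded_measurableM.
Qed.

Lemma torus_mean_horner p :
  torus_mean (fun t => p.[uavg t]) = pmoment (uavg_moment R) p.
Proof.
have bm n := bounded_measurable_horner (\sum_(i < n) p`_i *: 'X^i).
have bX n := bounded_measurableX n (bounded_measurable_uavg R).
suff H n : torus_mean (fun t => (\sum_(i < n) p`_i *: 'X^i).[uavg t]) =
    \sum_(i < n) p`_i * uavg_moment R i.
  by rewrite /pmoment -H -poly_def coefK.
elim: n => [|n IH].
  rewrite !big_ord0 (_ : (fun _ => _) = fun=> 0) ?torus_mean_cst//.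
  by apply/funext => t; rewrite horner0.
rewrite [RHS]big_ord_recr /= -IH -torus_meanZ// -torus_meanD//; last first.
  by apply: bounded_measurableM => //; exact: bounded_measurable_cst.
by congr torus_mean; apply/funext => t; rewrite big_ord_recr/= hornerD hornerZ hornerXn.
Qed.

Lemma measurable_ln_normc_affine a b :
  measurable_fun setT (fun t => ln (normc (a + b * (uavg t)%:C%C))).
Proof.
have [mu _] := bounded_measurable_uavg R.
apply: measurableT_comp; first exact: measurable_ln.
rewrite (_ : (fun _ => _) = @Num.sqrt R \o (fun t =>
    (Re a + Re b * uavg t) ^+ 2 + (Im a + Im b * uavg t) ^+ 2)); last first.
  apply/funext => t; case: a => a1 a2; case: b => b1 b2 /=.
  by rewrite !mulr0 subr0 add0r.
have ms : measurable_fun setT (@Num.sqrt R).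
  by apply: continuous_measurable_fun; exact: sqrt_continuous.
apply: (measurableT_comp ms).
have mc (c : R) : measurable_fun setT (fun _ : R * R => c) by exact: measurable_cst.
by apply: measurable_funD; apply: measurable_funX; apply: measurable_funD => //;
   apply: measurable_funM.
Qed.

Lemma bounded_measurable_ln_normc_affine a b M :
  (forall t, `|ln (normc (a + b * (uavg t)%:C%C))| <= M) ->
  bounded_measurable (fun t => ln (normc (a + b * (uavg t)%:C%C))).
Proof. by move=> hM; split; [exact: measurable_ln_normc_affine | exists M]. Qed.

(** The truncation estimate with no terms bounds the logarithm itself. *)
Lemma bounded_measurable_log_linear k : normc k < 1 ->
  bounded_measurable (fun t => ln (normc (1 + k * (uavg t)%:C%C))).
Proof.
move=> k1; apply: bounded_measurable_ln_normc_affine => t.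
have := ler_ln_normc_logser 0 (normr_uavg_le1 t) (lexx _) k1.
by rewrite /logser big_ord0 horner0 addr0; exact.
Qed.

Lemma bounded_measurable_log_quadratic k : normc k < 1 ->
  bounded_measurable (fun t => ln (normc (1 + k ^+ 2 + 2 * k * (uavg t)%:C%C))).
Proof.
move=> k1; apply: bounded_measurable_ln_normc_affine => t.
have := ler_ln_normc_chebser 0 (normr_uavg_le1 t) (lexx _) k1.
by rewrite /chebser big_ord0 horner0 addr0; exact.
Qed.

Lemma torus_mean_log_linear k N : normc k < 1 ->
  `|torus_mean (fun t => ln (normc (1 + k * (uavg t)%:C%C))) +
    pmoment (uavg_moment R) (logser k N)| <= normc k ^+ N.+1 / (1 - normc k).
Proof.
move=> k1; have bl := bounded_measurable_log_linear k1.
have bh := bounded_measurable_horner (logser k N).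
rewrite -torus_mean_horner -torus_meanD//.
apply: ler_norm_torus_mean; first exact: bounded_measurableD.
by move=> t; apply: ler_ln_normc_logser => //; exact: normr_uavg_le1.
Qed.

Lemma torus_mean_log_quadratic k N : normc k < 1 ->
  `|torus_mean (fun t => ln (normc (1 + k ^+ 2 + 2 * k * (uavg t)%:C%C))) +
    pmoment (uavg_moment R) (chebser k N)| <=
  2 * (normc k ^+ N.+1 / (1 - normc k)).
Proof.
move=> k1; have bl := bounded_measurable_log_quadratic k1.
have bh := bounded_measurable_horner (chebser k N).
rewrite -torus_mean_horner -torus_meanD//.
apply: ler_norm_torus_mean; first exact: bounded_measurableD.
by move=> t; apply: ler_ln_normc_chebser => //; exact: normr_uavg_le1.
Qed.

Lemma normc_iM k : normc ('i%C * k) = normc k.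
Proof. by rewrite Normc.normcM /= expr0n expr1n add0r sqrtr1 mul1r. Qed.

(** The truncated means cancel by [pmoment_logser], so the two sides differ by errors that tend to
    0. *)
Lemma torus_mean_log_identity k : normc k < 1 ->
  torus_mean (fun t => ln (normc (1 + k ^+ 2 * (uavg t)%:C%C))) =
  torus_mean (fun t => ln (normc (1 + k ^+ 2 + 2 * k * (uavg t)%:C%C))) +
  torus_mean (fun t =>
    ln (normc (1 + ('i%C * k) ^+ 2 + 2 * ('i%C * k) * (uavg t)%:C%C))).
Proof.
move=> k1; have ik1 : normc ('i%C * k) < 1 by rewrite normc_iM.
have k0 := normc_ge0 k; pose rho := normc k.
have k21 : normc (k ^+ 2) < 1 by rewrite normcX expr_lt1.
have k2r : normc (k ^+ 2) <= rho by rewrite normcX expr2 ler_piMl// ltW.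
set m0 := LHS; set m1 := (X in _ = X + _); set m2 := (X in _ = _ + X).
pose e N := rho ^+ N.+1 / (1 - rho).
have rle N : 0 <= rho ^+ N.+1 by rewrite exprn_ge0.
(* The constant 5 is 1 for the linear factor plus 2 for each quadratic one. Since |k^2| <= [rho] and
   2N + 1 >= N + 1, the one quantity [e N] serves for all three errors. *)
have bound N : `|m0 - (m1 + m2)| <= 5 * e N.
  have h0 : `|m0 + pmoment (uavg_moment R) (logser (k ^+ 2) N)| <= e N.
    apply: le_trans (torus_mean_log_linear N k21) _.
    apply: ler_pM; rewrite ?exprn_ge0 ?normc_ge0 ?invr_ge0 ?subr_ge0//.
    - exact: ltW.
    - by rewrite lerXn2r ?nnegrE ?normc_ge0.
    - by rewrite lef_pV2 ?posrE ?subr_gt0// lerD2l lerN2.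
  have le2 : rho ^+ N.*2.+1 / (1 - rho) <= e N.
    rewrite ler_pM2r ?invr_gt0 ?subr_gt0// ler_wiXn2l//; first exact: ltW.
    by rewrite -addnn ltnS leq_addr.
  have h1 := torus_mean_log_quadratic N.*2 k1.
  have h2 := torus_mean_log_quadratic N.*2 ik1.
  rewrite normc_iM in h2; rewrite -/m1 -/m2 -/rho in h1 h2.
  have E := pmoment_logser (uavg_moment0 R) (@uavg_momentS R) k N.
  move: h0 h1 h2 le2; rewrite E.
  move: (pmoment _ (chebser k _)) (pmoment _ (chebser ('i%C * k) _)) => A1 A2.
  move=> h0 h1 h2 le2.
  rewrite (_ : m0 - (m1 + m2) = m0 + (A1 + A2) - (m1 + A1 + (m2 + A2))); last by ring.
  apply: le_trans (ler_normB _ _) _; rewrite (_ : 5 * e N = e N + 4 * e N); last by ring.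
  apply: lerD h0 _; apply: le_trans (ler_normD _ _) _.
  by apply: le_trans (lerD h1 h2) _; rewrite -mulr2n -mulr_natr; lra.
apply/eqP; rewrite -subr_eq0 -normr_le0.
have c5 : 5 * e N @[N --> \oo] --> (0 : R).
  rewrite (_ : (fun N => 5 * e N) = fun N => (5 / (1 - rho) * rho) * rho ^+ N); last first.
    by apply/funext => N; rewrite /e exprS; ring.
  rewrite -[X in _ --> X](mulr0 (5 / (1 - rho) * rho)).
  by apply: cvgM; [exact: cvg_cst | apply: cvg_expr; rewrite ger0_norm].
apply: (cvgr_to_ge c5); exact: nearW bound.
Qed.

Lemma expiDV (t : R) : expi t + (expi t)^-1 = (2 * cos t)%:C%C.
Proof.
apply/eqP; rewrite eq_complex/= cos2Dsin2 !divr1 subrr eqxx andbT.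
by rewrite mulr_natl mulr2n.
Qed.

(** On the torus x + 1/x + y + 1/y = 4 [uavg], so with ac = 4 the polynomial is a (b + c [uavg]).
    Nonvanishing lets the logarithm of the product split, and boundedness makes the extended real
    integral finite. *)
Lemma mahler2_family a b c :
  bounded_measurable (fun t => ln (normc (b + c * (uavg t)%:C%C))) ->
  a != 0 -> a * c = 4 -> (forall t, b + c * (uavg t)%:C%C != 0) ->
  mahler2 (fun x y : R[i] => a * b + x + x^-1 + y + y^-1) =
  (ln (normc a) + torus_mean (fun t => ln (normc (b + c * (uavg t)%:C%C))))%:E.
Proof.
move=> bf a0 ac nz.
have bc := bounded_measurable_cst (ln (normc a)).
rewrite -[X in (X + _)%:E]torus_mean_cst -torus_meanD// /mahler2.
rewrite /torus_mean /Rintegral fineK; last first.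
  apply: integrable_fin_num; first exact: measurableX.
  by apply: bounded_measurable_integrable; exact: bounded_measurableD.
apply: eq_integral => t _; congr EFin.
rewrite -lnM ?posrE ?normc_gt0// -Normc.normcM; congr (ln (normc _)).
rewrite [RHS]mulrDr [a * (c * _)]mulrA ac -!addrA (addrA (expi _)) !expiDV; congr (_ + _).
by apply/eqP; rewrite eq_complex /uavg /ucos /=; apply/andP; split; apply/eqP; field.
Qed.

End MahlerMeasure.

Local Close Scope classical_set_scope.
Unset Implicit Arguments.

Theorem mainTheorem5 (R : realType) (k : R[i]) :
  (0 < Normc.normc k)%R -> (Normc.normc k < 1)%R ->
  mahler2 (fun x y : R[i] => (4 / k ^+ 2 + x + x^-1 + y + y^-1)%R) =
  adde (mahler2 (fun x y : R[i] => (2 * (k + k^-1) + x + x^-1 + y + y^-1)%R))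
   (mahler2 (fun x y : R[i] => (2 * 'i%C * (k - k^-1) + x + x^-1 + y + y^-1)%R)).
Proof.
move=> k0 k1.
have kn0 : k != 0 by apply: contraTneq k0 => ->; rewrite Normc.normc0 ltxx.
have ik1 : Normc.normc ('i%C * k) < 1 by rewrite normc_iM.
have k21 : Normc.normc (k ^+ 2) < 1 by rewrite normcX expr_lt1// normc_ge0.
have i0 : 'i%C != 0 :> R[i] by rewrite eq_complex/= oner_eq0 andbF.
have i2 : 'i%C ^+ 2 = -1 :> R[i] by exact: sqr_i.
have nk2 : k ^+ 2 != 0 by rewrite expf_neq0.
have n2k : 2 / k != 0 by rewrite mulf_neq0 ?invr_neq0 ?pnatr_eq0.
have n2ik : - (2 * 'i%C) / k != 0.
  by rewrite mulf_neq0 ?invr_neq0// oppr_eq0 mulf_neq0 ?pnatr_eq0.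
(* The constant terms are brought to the form ab, with a equal to 4/k^2, 2/k and -2i/k. The third
   case is the second with ik for k, since 2(ik + 1/(ik)) = 2i(k - 1/k). *)
have -> : mahler2 (fun x y : R[i] => 4 / k ^+ 2 + x + x^-1 + y + y^-1) =
    mahler2 (fun x y : R[i] => (4 / k ^+ 2) * 1 + x + x^-1 + y + y^-1).
  by congr mahler2; apply/funext => x; apply/funext => y; rewrite mulr1.
have -> : mahler2 (fun x y : R[i] => 2 * (k + k^-1) + x + x^-1 + y + y^-1) =
    mahler2 (fun x y : R[i] => (2 / k) * (1 + k ^+ 2) + x + x^-1 + y + y^-1).
  congr mahler2; apply/funext => x; apply/funext => y; do 4 congr (_ + _).
  by field.
have -> : mahler2 (fun x y : R[i] => 2 * 'i%C * (k - k^-1) + x + x^-1 + y + y^-1) =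
    mahler2 (fun x y : R[i] => (- (2 * 'i%C) / k) * (1 + ('i%C * k) ^+ 2)
      + x + x^-1 + y + y^-1).
  congr mahler2; apply/funext => x; apply/funext => y; do 4 congr (_ + _).
  by rewrite exprMn i2; field.
rewrite (mahler2_family (c := k ^+ 2) (bounded_measurable_log_linear k21)); last 3 first.
- by rewrite mulf_neq0 ?invr_neq0 ?pnatr_eq0.
- by rewrite mulfVK.
- by move=> t; apply: linear_neq0 => //; exact: normr_uavg_le1.
rewrite (mahler2_family (c := 2 * k) (bounded_measurable_log_quadratic k1))//; last 2 first.
- by field.
- by move=> t; apply: quadratic_neq0 => //; exact: normr_uavg_le1.
rewrite (mahler2_family (c := 2 * ('i%C * k)) (bounded_measurable_log_quadratic ik1))//;
  last 2 first.
- by transitivity (- (4 * 'i%C ^+ 2) : R[i]); [field | rewrite i2; ring].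
- by move=> t; apply: quadratic_neq0 => //; exact: normr_uavg_le1.
have addE (x y : R) : adde x%:E y%:E = (x + y)%:E by [].
rewrite addE; congr EFin; rewrite (torus_mean_log_identity k1) addrACA; congr (_ + _).
rewrite -lnM ?posrE ?normc_gt0// -Normc.normcM; congr ln.
(* The prefactors match in modulus: the product of the last two is the first times -i. *)
have -> : 2 / k * (- (2 * 'i%C) / k) = - ('i%C * (4 / k ^+ 2)) by field.
by rewrite normcN normc_iM.
Qed.
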